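(* Let $(x_n)_{n\ge1}$ be a monotone increasing sequence of positive integers such that for some $r>0$ and all $N$, $$E_N:=\#\{(a,b,c,d)\in[1,N]^4 : x_a+x_b=x_c+x_d\}\ge rN^3.$$ Then there exist increasing sequences of positive integers $(n_k)_{k\ge1}$ and $(a_N)_{N\ge1}$ with $n_k\to\infty$, $a_N\to\infty$, such that $(n_k)$ has density bounded from below in $\{1,\dots,a_N\}$ (i.e. there is $c>0$ with $\#\{k : n_k\le a_N\}\ge c\,a_N$ for all $N$), and for every $\varepsilon>0$ and almost every $\alpha\in\mathbb{R}$, $$\min\big\{\|\alpha x_{n_k}-\alpha x_{n_l}\| : k\ne l,\ n_k,n_l\le a_N\big\}\gg\frac{1}{a_N(\log a_N)^{1+\varepsilon}},$$ where the implied constant may depend on $\alpha$ and $\varepsilon$.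
   Context: For $x\in\mathbb{R}$, $\|x\|=\min_{k\in\mathbb{Z}}|x-k|$ is the distance to the nearest integer. The left-hand side of the conclusion is the minimal gap modulo 1 among the points $\alpha x_{n_k}$ with $n_k\le a_N$ (written $\delta_{\min}^{\alpha}(x_{n_k},a_N)$ in the paper). *)

(* Defs.v *)
From HB Require Import structures.
From mathcomp Require Import all_boot all_order all_algebra.
From mathcomp Require Import all_classical all_reals all_analysis.
Set Implicit Arguments. Unset Strict Implicit. Unset Printing Implicit Defensive.
Import Order.TTheory GRing.Theory Num.Theory.
Local Open Scope ring_scope.

Definition distZ {R : realType} (x : R) : R :=
  Num.min (x - (Num.floor x)%:~R) ((Num.ceil x)%:~R - x).

(* E_N = #{(a,b,c,d) in [1,N]^4 : x_a + x_b = x_c + x_d}; sequences are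
   indexed from 1, ordinal i : 'I_N stands for the index i+1. *)
Definition additive_energy (x : nat -> nat) (N : nat) : nat :=
  #|[set t : 'I_N * 'I_N * 'I_N * 'I_N |
      (x t.1.1.1.+1 + x t.1.1.2.+1 == x t.1.2.+1 + x t.2.+1)%N]|.

(* #{k >= 1 : n_k <= A} for a sequence n indexed from 1 with n_k >= k *)
Definition count_le (n : nat -> nat) (A : nat) : nat :=
  \sum_(1 <= k < A.+1) (n k <= A)%N.

(* Main.v *)
Require Import Defs.
From HB Require Import structures.
From mathcomp Require Import all_boot all_order all_algebra.
From mathcomp Require Import all_classical all_reals all_analysis.
From mathcomp Require Import zify lra.
Set Implicit Arguments. Unset Strict Implicit. Unset Printing Implicit Defensive.
Import Order.TTheory GRing.Theory Num.Theory.
Import numFieldNormedType.Exports.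
Local Open Scope ring_scope.

(** The Balog-Szemeredi-Gowers argument extracts from [x_1, ..., x_N] a
    subset of positive proportion with only [O(N)] differences.  For a nonzero
    integer [h], the set of [alpha] in [[-m, m]] with [distZ (alpha h) < d] has
    measure [O(m d)], so a family of [O(N)] differences is harmless at level
    [1 / (N ln N)] up to a set of measure [O(m / ln N)].  Since the scales [a_N]
    are ours to choose, they can grow so fast that the dense subset of
    [(a_N, a_(N+1)]] may be added to everything chosen before: the at most
    [2 a_N a_(N+1)] differences across two blocks are absorbed by [ln a_(N+1)],
    and the exceptional measures are summable, so that Borel-Cantelli applies. *)

(** * Counting representations by differences and by their sums *)

Definition rep (P : finType) (V : eqType) (f : P -> V) (h : V) : nat :=
  (\sum_p (f p == h))%N.

Lemma sum_rep_le (P : finType) (V : eqType) (f : P -> V) (s : seq V) :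
  uniq s -> (\sum_(h <- s) rep f h <= #|P|)%N.
Proof.
move=> us; rewrite /rep exchange_big /= -sum1_card.
apply: leq_sum => p _.
have -> : (\sum_(h <- s) (f p == h) = count_mem (f p) s)%N.
  rewrite -sum1_count [RHS]big_mkcond; apply: eq_bigr => h _ /=.
  by rewrite eq_sym; case: eqP.
by rewrite count_uniq_mem// leq_b1.
Qed.

Definition difference (T : Type) (V : zmodType) (X : T -> V) (p : T * T) : V :=
  X p.1 - X p.2.

Definition split_sum (P Q : Type) (V : zmodType) (f : P -> V) (g : Q -> V)
  (p : P * Q) : V := f p.1 + g p.2.

(** A representation of [X a - X y] followed by one of [X y - X b] represents [X a - X b]. The value
    of the first part determines [y] by injectivity of [X], so distinct [y] never count the same
    pair. *)
Lemma rep_split_sum (P Q T : finType) (V : zmodType) (f : P -> V) (g : Q -> V)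
    (X : T -> V) (B : {pred T}) (a b : T) : injective X ->
  (\sum_(y in B) rep f (X a - X y)%R * rep g (X y - X b)%R
     <= rep (split_sum f g) (X a - X b)%R)%N.
Proof.
move=> Xinj.
have -> : (\sum_(y in B) rep f (X a - X y)%R * rep g (X y - X b)%R =
    \sum_(p : P * Q) \sum_(y in B)
      (f p.1 == (X a - X y)%R) * (g p.2 == (X y - X b)%R))%N.
  rewrite exchange_big /=; apply: eq_bigr => y _.
  rewrite /rep big_distrlr /= pair_big /=.
  by apply: eq_bigr.
apply: leq_sum => -[p q] _ /=; rewrite /split_sum /=.
have [e|ne] := eqVneq (f p + g q) (X a - X b).
  have [y0 fy0|none] := pickP (fun y => f p == X a - X y); last first.
    by rewrite big1// => y _; rewrite none.
  apply: (@leq_trans (\sum_(y | y == y0) 1)%N); last by rewrite big_pred1_eq.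
  rewrite [leqRHS]big_mkcond [leqLHS]big_mkcond /=; apply: leq_sum => y _.
  case: ifP => // _.
  have [->|neq] := eqVneq y y0; first by case: eqP => //; case: eqP.
  case: eqP => //= E; exfalso; move/eqP: neq; apply; apply: Xinj.
  by move: E; rewrite (eqP fy0) => /addrI /oppr_inj.
rewrite big1// => y _.
have [ep|] := eqVneq (f p) (X a - X y) => //.
have [eq|] := eqVneq (g q) (X y - X b) => //.
by move: ne; rewrite ep eq addrA subrK eqxx.
Qed.

(** * Cauchy-Schwarz and dependent random choice *)

Lemma sum_sqr_ge (I : finType) (d : I -> nat) :
  ((\sum_i d i) ^ 2 <= #|I| * \sum_i d i ^ 2)%N.
Proof.
(* Twice the claim is [2 d_i d_j <= d_i^2 + d_j^2] summed over all pairs. *)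
rewrite -(leq_pmul2l (isT : (0 < 2)%N)).
have -> : (2 * (#|I| * \sum_i d i ^ 2) = \sum_i \sum_j (d i ^ 2 + d j ^ 2))%N.
  under [RHS]eq_bigr => i _ do rewrite big_split /= sum_nat_const.
  by rewrite big_split /= sum_nat_const -big_distrr /= mul2n -addnn.
rewrite expnS expn1 big_distrlr /= big_distrr /=; apply: leq_sum => i _.
rewrite big_distrr /=; apply: leq_sum => j _.
exact: nat_Cauchy.
Qed.

Definition nbhd (T : finType) (G : rel T) (v : T) : {set T} := [set a | G v a].

Definition codegree (T : finType) (G : rel T) (a b : T) : nat :=
  #|[set v | (a \in nbhd G v) && (b \in nbhd G v)]|.

(* Averaging over [v]: a pair of small codegree lies in few of the neighbourhoods. *)
Lemma dependent_random_choice (T : finType) (G : rel T) (D : nat) :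
  let M := (32 * D ^ 2)%N in
  (0 < #|T|)%N -> (#|T| ^ 2 <= D * \sum_v #|nbhd G v|)%N ->
  exists v, (#|T| ^ 2 + M * #|[set p | [&& p.1 \in nbhd G v, p.2 \in nbhd G v
      & M * codegree G p.1 p.2 < #|T|]]| <= 2 * D ^ 2 * #|nbhd G v| ^ 2)%N.
Proof.
move=> M T0 dens; apply/existsP; rewrite -[X in is_true X]negbK; apply/negP.
rewrite negb_exists => /forallP H.
set bad := fun v => #|[set p : T * T| [&& p.1 \in nbhd G v, p.2 \in nbhd G v
      & (M * codegree G p.1 p.2 < #|T|)%N]]|.
have {}H v : (2 * D ^ 2 * #|nbhd G v| ^ 2 < #|T| ^ 2 + M * bad v)%N.
  by have := H v; rewrite -ltnNge.
(* Double counting: a pair lies in as many neighbourhoods as its codegree, which is below [#|T| / M]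
   for the pairs counted here. *)
have sumbad : (M * \sum_v bad v <= #|T| ^ 3)%N.
  have -> : (\sum_v bad v = \sum_(p : T * T | M * codegree G p.1 p.2 < #|T|)
      codegree G p.1 p.2)%N.
    rewrite /bad; under eq_bigr => v _ do rewrite -sum1_card big_mkcond /=.
    rewrite exchange_big /= [RHS]big_mkcond /=; apply: eq_bigr => p _.
    rewrite /codegree; case: ifP => h.
      rewrite -[RHS]sum1_card [RHS]big_mkcond /=; apply: eq_bigr => v _.
      by rewrite !inE /= h andbT.
    by rewrite big1// => v _; rewrite !inE h !andbF.
  rewrite big_distrr /=; apply: (@leq_trans (\sum_(p : T * T) #|T|)%N).
    rewrite big_mkcond; apply: leq_sum => p _.
    by case: ifP => // /ltnW.
  by rewrite sum_nat_const card_prod -mulnA mulnn -expnS.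
(* Summed over [v], the negated claim bounds [2 * D ^ 2] times the sum of squared degrees strictly
   by [2 * #|T| ^ 3]. Cauchy-Schwarz and the density hypothesis give the opposite inequality. *)
have : (\sum_v (2 * D ^ 2 * #|nbhd G v| ^ 2) < \sum_v (#|T| ^ 2 + M * bad v))%N.
  have [v0 _] : exists v0 : T, v0 \in T by apply/card_gt0P.
  rewrite (bigD1 v0)//= [X in (_ < X)%N](bigD1 v0)//= -addSn leq_add//.
  by apply: leq_sum => v _; apply: ltnW.
rewrite -big_distrr big_split /= sum_nat_const -expnS -big_distrr /=.
move: sumbad; set B := (M * _)%N => sumbad.
have S := sum_sqr_ge (fun v => #|nbhd G v|); move: dens S.
set d := (\sum_v #|nbhd G v|)%N; set q := (\sum_v #|nbhd G v| ^ 2)%N => dens S L.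
have : (#|T| ^ 3 <= D ^ 2 * q)%N.
  rewrite -(leq_pmul2l T0); apply: (@leq_trans ((D * d) ^ 2)).
    by rewrite -expnS -[4%N]/(2 * 2)%N expnM leq_exp2r.
  by rewrite expnMn mulnCA leq_mul2l S orbT.
move: sumbad; rewrite -[#|xpredT|]/#|T| -mulnA in L *.
by move: (#|T| ^ 3)%N (D ^ 2 * q)%N L => c e; lia.
Qed.

(** * The Balog-Szemeredi-Gowers theorem *)

Lemma rep_differenceN (T : finType) (V : zmodType) (X : T -> V) (h : V) :
  rep (difference X) (- h) = rep (difference X) h.
Proof.
rewrite /rep (reindex_inj (h := fun p : T * T => (p.2, p.1))) /=; last first.
  by move=> [a b] [c d] [-> ->].
by apply: eq_bigr => p _; rewrite /difference /= -opprB eqr_opp.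
Qed.

Lemma rep_difference_le (T : finType) (V : zmodType) (X : T -> V) (h : V) :
  injective X -> (rep (difference X) h <= #|T|)%N.
Proof.
move=> Xinj; rewrite /rep -(pair_bigA _ (fun a b => (difference X (a, b) == h) : nat)) /=.
rewrite -sum1_card; apply: leq_sum => a _.
have [b0 hb0|none] := pickP (fun b => difference X (a, b) == h); last first.
  by rewrite big1// => b _; rewrite none.
rewrite (bigD1 b0)//= hb0 big1// => b /negP nb; case: eqP => // hb; exfalso; apply: nb.
by apply/eqP/Xinj/oppr_inj; apply: (addrI (X a)); move/eqP: hb0; rewrite -hb.
Qed.

Lemma leq_chain (N n b d m r e : nat) : (N <= d * n)%N -> (n <= 2 * b)%N ->
  (b * e <= m * r)%N -> (N * e <= d * (2 * m) * r)%N.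
Proof.
move=> Nn nb be; have h : (N <= d * (2 * b))%N by rewrite (leq_trans Nn)// leq_mul2l nb orbT.
rewrite (leq_trans (leq_mul h (leqnn e)))// -!mulnA !leq_mul2l.
by rewrite be !orbT.
Qed.

Section BalogSzemerediGowers.
Variables (T : finType) (V : zmodType) (X : T -> V) (K : nat).
Hypothesis Xinj : injective X.
Hypothesis energy :
  (#|T| ^ 3 <= K * \sum_(p : T * T) rep (difference X) (difference X p))%N.
Hypothesis T_gt0 : (0 < #|T|)%N.

Let N := #|T|.
Let D := (2 * K)%N.
Let M := (32 * D ^ 2)%N.

Definition popular : rel T :=
  fun a b => (N <= D * rep (difference X) (X a - X b)%R)%N.

Lemma popularC a b : popular a b = popular b a.
Proof. by rewrite /popular -opprB rep_differenceN. Qed.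

(** Unpopular pairs contribute less than [N / D] each, hence at most half of the [N ^ 3 / K]
    guaranteed by [energy]; a popular pair contributes at most [N]. *)
Lemma popular_dense : (N ^ 2 <= D * \sum_v #|nbhd popular v|)%N.
Proof.
have -> : (\sum_v #|nbhd popular v| = \sum_(p : T * T) popular p.1 p.2)%N.
  rewrite -(pair_bigA _ (fun a b => popular a b : nat)) /=; apply: eq_bigr => v _.
  by rewrite -sum1_card big_mkcond; apply: eq_bigr => b _; rewrite inE; case: ifP.
(* The added [N ^ 3] is one [N] for each pair, so that the inequality can be checked pair by
   pair. *)
rewrite -(leq_pmul2l T_gt0) -expnS -(leq_add2r (N ^ 3)) addnn -mul2n.
apply: (@leq_trans (2 * (K * \sum_(p : T * T) rep (difference X) (difference X p)))).
  by rewrite leq_mul2l energy.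
rewrite mulnA -/D big_distrr /=.
rewrite (_ : N ^ 3 = \sum_(p : T * T) N)%N; last first.
  by rewrite sum_nat_const card_prod -mulnA mulnn -expnS.
rewrite mulnCA 2!big_distrr /= -big_split /=; apply: leq_sum => p _.
have := rep_difference_le (difference X p) Xinj.
rewrite /popular -/(difference X p) -/N; move: (rep _ _) => c cN.
by case: (leqP N (D * c)) => h; rewrite ?muln1 ?muln0; nia.
Qed.

(** Each of at least [N / M] common neighbours [y] splits [X a - X b] into [X a - X y] and
    [X y - X b], both with at least [N / D] representations. *)
Lemma rep2_lower a b : (N <= M * codegree popular a b)%N ->
  (N ^ 3 <= M * D ^ 2 * rep (split_sum (difference X) (difference X)) (X a - X b)%R)%N.
Proof.
move=> Nab.
have := rep_split_sum (difference X) (difference X)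
  [set v | (a \in nbhd popular v) && (b \in nbhd popular v)] a b Xinj.
set r2 := rep _ _ => r2_ge.
apply: (@leq_trans (M * codegree popular a b * N ^ 2)); first by rewrite expnS leq_mul2r Nab orbT.
rewrite -(mulnA M) -(mulnA M (D ^ 2)%N) leq_mul2l; apply/orP; right.
apply: leq_trans (leq_mul (leqnn (D ^ 2)%N) r2_ge).
rewrite /codegree -sum_nat_const big_distrr /=; apply: leq_sum => y.
rewrite !inE => /andP[ya yb]; rewrite -(mulnn N) -(mulnn D) mulnACA; apply: leq_mul => //.
by move: ya; rewrite popularC.
Qed.

(** The product of the losses: [2 * D] for the size of the neighbourhood, 2 for the midpoints of the
    paths, [M * D ^ 2] for each half of a path. *)
Definition BSG_const := (2 * D * (2 * (M * D ^ 2) ^ 2))%N.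

(** Dependent random choice gives a large neighbourhood [A'] with few pairs of small codegree; [A]
    keeps the points of [A'] that form such a bad pair with at most a quarter of [A']. *)
Lemma balog_szemeredi_gowers_pos : exists A : {set T},
  (N <= 8 * K * #|A|)%N /\
  (size (undup [seq difference X p | p <- enum (finset.setX A A)]) <= BSG_const * N)%N.
Proof.
have [v hv] := dependent_random_choice T_gt0 popular_dense.
rewrite -/N -/M in hv.
set A' := nbhd popular v in hv *; set n := #|A'| in hv.
pose bad a b := (M * codegree popular a b < N)%N.
have badC a b : bad a b = bad b a.
  rewrite /bad; congr (_ * _ < _)%N; apply: eq_card => w.
  by rewrite !inE andbC.
pose row a := [set b in A' | bad a b].
move: hv; set W := (X in (M * #|pred_of_set X|)%N) => hv.
have cardW : #|W| = (\sum_(a in A') #|row a|)%N.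
  rewrite -sum1_card big_mkcond /=.
  rewrite (eq_bigr (fun p => if (p.1, p.2) \in W then 1 else 0)%N); last by case.
  rewrite -(pair_bigA _ (fun a b => if (a, b) \in W then 1 else 0)%N) /=.
  rewrite [RHS]big_mkcond; apply: eq_bigr => a _.
  case: ifP => aA; last by rewrite big1// => b _; rewrite inE /= aA.
  rewrite -sum1_card [RHS]big_mkcond; apply: eq_bigr => b _.
  by rewrite [(a, b) \in W]inE [b \in row a]inE /= aA.
have K0 : (0 < K)%N.
  rewrite lt0n; apply: contraTN energy => /eqP ->.
  by rewrite mul0n -ltnNge expn_gt0 T_gt0.
have D0 : (0 < D)%N by rewrite muln_gt0 K0.
(* The factor 32 in [M] is chosen for this bound. *)
have Wn : (16 * #|W| <= n ^ 2)%N.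
  have DD0 : (0 < 2 * D ^ 2)%N by rewrite muln_gt0 expn_gt0 D0.
  rewrite -(leq_pmul2l DD0) (leq_trans _ hv)// (leq_trans _ (leq_addl _ _))//.
  by rewrite /M mulnA leq_mul2r; apply/orP; right; lia.
have Nn : (N <= 2 * D * n)%N.
  rewrite -leq_sqr (leq_trans (leq_addr _ _) (leq_trans hv _))//.
  rewrite !expnMn leq_mul2r; apply/orP; right.
  by rewrite leq_mul2r orbT.
have n0 : (0 < n)%N.
  by move: Nn T_gt0; rewrite /N; case: (n) => //; rewrite muln0 leqn0 => /eqP ->.
pose A := [set a in A' | (4 * #|row a| <= n)%N].
(* Markov's inequality: a discarded point has more than [n / 4] bad partners, and there are at most
   [n ^ 2 / 16] bad pairs. *)
have cardA : (3 * n <= 4 * #|A|)%N.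
  have AA : A \subset A' by apply/fintype.subsetP => a; rewrite inE => /andP[].
  have : (4 * #|A' :\: A| <= n)%N.
    rewrite -(leq_pmul2l n0) mulnn; apply: leq_trans Wn.
    rewrite cardW -[16%N]/(4 * 4)%N mulnCA -mulnA leq_mul2l /=.
    rewrite (big_setID A) /= mulnDr (leq_trans _ (leq_addl _ _))//.
    rewrite mulnC -sum_nat_const big_distrr /=; apply: leq_sum => a.
    by rewrite !inE => /andP[+ aA]; rewrite aA /= -ltnNge => /ltnW.
  have := cardsID A A'; rewrite (finset.setIidPr AA) -/n.
  by move: #|A| #|A' :\: A| => u w; lia.
exists A; split.
  by move: Nn cardA; rewrite /D; nia.
(* Any two points of [A] are joined by many paths of length 4 in the popular
   graph, so each difference has at least [N ^ 7 / BSG_const] representations as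
   a signed sum of 8 terms, out of [N ^ 8] in total. *)
set f2 := split_sum (difference X) (difference X).
have r4 a b : a \in A -> b \in A ->
    (N ^ 7 <= BSG_const * rep (split_sum f2 f2) (X a - X b)%R)%N.
  rewrite 2!inE => /andP[aA' ra] /[!inE] /andP[bA' rb].
  pose B := [set y in A' | ~~ bad a y & ~~ bad y b].
  (* The points of [A'] outside [B] lie in [row a] or [row b], each at most a quarter of [A']. *)
  have nB : (n <= 2 * #|B|)%N.
    have : A' \subset B :|: (row a :|: row b).
      apply/fintype.subsetP => y yA'; rewrite !inE in yA' *; rewrite yA' /= (badC b).
      by case: (bad a y) => //=; case: (bad y b).
    move=> /subset_leq_card; rewrite -/n => nle.
    have := leq_trans nle (leq_card_setU _ _).
    have := (leq_card_setU (row a) (row b)).1.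
    by move: #|row a| #|row b| ra rb #|B| #|_ :|: _| => u ru w rw z t; lia.
  have := rep_split_sum f2 f2 B a b Xinj.
  set r := rep _ _ => r_ge.
  have -> : (N ^ 7 = N * (N ^ 3) ^ 2)%N by rewrite -expnM -expnS.
  apply: leq_chain Nn nB _.
  apply: leq_trans (leq_mul (leqnn _) r_ge).
  rewrite -sum_nat_const big_distrr /=; apply: leq_sum => y.
  rewrite inE => /andP[_]; rewrite /bad -!leqNgt => /andP[ay yb].
  rewrite -(mulnn (N ^ 3)) -(mulnn (M * D ^ 2)) mulnACA.
  apply: leq_mul; exact: rep2_lower.
have N7 : (0 < N ^ 7)%N by rewrite expn_gt0 T_gt0.
rewrite -(leq_pmul2r N7).
set s := undup _.
apply: (@leq_trans (\sum_(h <- s) BSG_const * rep (split_sum f2 f2) h)%N).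
  rewrite -sum1_size big_distrl /= big_seq [leqRHS]big_seq.
  apply: leq_sum => h hs; rewrite mul1n.
  move: hs; rewrite mem_undup => /mapP[[a b]]; rewrite mem_enum => /finset.setXP[/= aA bA] ->.
  exact: r4.
rewrite -big_distrr /= -mulnA leq_mul2l; apply/orP; right.
rewrite (leq_trans (sum_rep_le _ (undup_uniq _)))// !card_prod -/N.
by rewrite -expnS !mulnn -!expnM.
Qed.

End BalogSzemerediGowers.

Lemma balog_szemeredi_gowers (T : finType) (V : zmodType) (X : T -> V) (K : nat) :
  injective X ->
  (#|T| ^ 3 <= K * \sum_(p : T * T) rep (difference X) (difference X p))%N ->
  exists A : {set T}, (#|T| <= 8 * K * #|A|)%N /\
  (size (undup [seq difference X p | p <- enum (finset.setX A A)]) <= BSG_const K * #|T|)%N.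
Proof.
move=> Xinj energy; have [T0|] := posnP #|T|; last first.
  exact: balog_szemeredi_gowers_pos energy.
exists finset.set0; rewrite T0; split => //.
rewrite (_ : enum _ = [::]) //; apply: size0nil; rewrite -cardE cardsX cards0 //.
Qed.

(** * Metric estimates and Borel-Cantelli *)

Lemma distZ_lt (R : realType) (t d : R) : distZ t < d ->
  exists2 k : int, `|t - k%:~R| < d & `|k|%:~R <= `|t| + 1.
Proof.
rewrite /distZ.
have /andP[fl fr] := real_floor_itv (num_real t).
have /andP[cl cr] := real_ceil_itv (num_real t).
rewrite gt_min => /orP[h|h].
- exists (Num.floor t); first by rewrite ger0_norm// subr_ge0.
  rewrite intr_norm ler_norml; move: fl fr; rewrite intrD; set k := _%:~R => fl fr.
  by have := ler_norm t; have := ler_norm (- t); rewrite normrN; lra.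
- exists (Num.ceil t); first by rewrite ler0_norm ?opprB// subr_le0.
  rewrite intr_norm ler_norml; move: cl cr; rewrite intrB; set k := _%:~R => cl cr.
  by have := ler_norm t; have := ler_norm (- t); rewrite normrN; lra.
Qed.

(* The shift [c] bounds the integers nearest to [alpha * h] when [`|alpha| <= m]. *)
Definition near_int_cover (R : realType) (m : nat) (d : R) (h : int) : set R :=
  let c := (m * `|h| + 1)%N in
  \big[setU/set0]_(i < (2 * c).+1)
    ball ((i%:Z - c%:Z)%:~R / h%:~R : R) (d / `|h|%:~R).

Lemma near_int_coverP (R : realType) (m : nat) (d : R) (h : int) (alpha : R) :
  h != 0 -> `|alpha| <= m%:R -> distZ (alpha * h%:~R) < d ->
  near_int_cover m d h alpha.
Proof.
move=> h0 am /distZ_lt[k kd kle]; rewrite /near_int_cover.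
set c := (m * `|h| + 1)%N.
have kc : (`|k|%N <= c)%N.
  rewrite -(ler_nat R) natr_absz (le_trans kle)// normrM /c natrD natrM lerD2r.
  by rewrite natr_absz intr_norm ler_wpM2r.
have hR : h%:~R != 0 :> R by rewrite intr_eq0.
pose i := absz (k + c%:Z).
have ik : i%:Z - c%:Z = k :> int by rewrite /i; lia.
have ic : (i < (2 * c).+1)%N by rewrite /i; lia.
apply: (bigsetU_sup (F := fun i => ball ((i%:Z - c%:Z)%:~R / h%:~R : R) (d / `|h|%:~R)) ic).
rewrite ik /ball /= intr_norm ltr_pdivlMr ?normr_gt0// -normrM mulrBl divfK//.
by rewrite distrC.
Qed.

Lemma measurable_near_int_cover (R : realType) (m : nat) (d : R) (h : int) :
  measurable (near_int_cover m d h : set R).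
Proof. by apply: bigsetU_measurable => i _; exact: measurable_realfun.measurable_ball. Qed.

(** There are [2 * m * |h| + 3 <= (2 * m + 3) * |h|] balls of length [2 * d / |h|], so [h] cancels
    and the bound is uniform in [h]. *)
Lemma measure_near_int_cover (R : realType) (m : nat) (d : R) (h : int) :
  h != 0 -> 0 <= d ->
  (lebesgue_measure (near_int_cover m d h) <= ((2 * m + 3)%:R * (2 * d))%:E)%E.
Proof.
move=> h0 d0; have hR : 0 < `|h|%:~R :> R by rewrite ltr0z normr_gt0.
rewrite /near_int_cover; set c := (m * `|h| + 1)%N.
pose F i := ball ((i%:Z - c%:Z)%:~R / h%:~R : R) (d / `|h|%:~R).
apply: (le_trans (Boole_inequality lebesgue_measure (A := F) _)).
  by move=> i _; exact: measurable_realfun.measurable_ball.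
apply: (@le_trans _ _ (\sum_(i < (2 * c).+1) (d / `|h|%:~R *+ 2)%:E)%E).
  apply: lee_sum => i _; rewrite le_eqVlt; apply/orP; left; apply/eqP/lebesgue_measure_ball.
  by rewrite divr_ge0// ltW.
rewrite sumEFin lee_fin big_const_ord iter_addr_0.
rewrite -mulrnA -[leLHS]mulr_natr [leLHS]mulrAC ler_pdivrMr//.
have -> : `|h|%:~R = `|h|%N%:R :> R by rewrite natr_absz.
have Lh : (2 * c).+1%:R <= (2 * m + 3)%:R * `|h|%N%:R :> R.
  rewrite -natrM ler_nat /c; have : (0 < `|h|)%N by rewrite absz_gt0.
  by move: `|h|%N => n; nia.
rewrite natrM; move: Lh; move: (_ %:R) (_ %:R) (_ %:R) => u v w.
by nra.
Qed.

(** Borel-Cantelli with the growing windows [[-N, N]], which makes a single null set serve the whole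
    line. *)
Lemma ae_distZ_ge (R : realType) (H : nat -> seq int) (d : nat -> R) :
  (forall N, 0 \notin H N) -> (forall N, 0 <= d N) ->
  (forall N, (size (H N))%:R * ((2 * N + 3)%:R * (2 * d N)) <= 1 / (2 ^ N.+1)%:R) ->
  {ae lebesgue_measure, forall alpha : R, exists N0, forall N, (N0 <= N)%N ->
     forall h, h \in H N -> d N <= distZ (alpha * h%:~R)}.
Proof.
move=> H0 d0 small.
pose F N : set R := \big[setU/set0]_(i < size (H N)) near_int_cover N (d N) (nth 0 (H N) i).
have mF N : measurable (F N).
  by apply: bigsetU_measurable => i _; exact: measurable_near_int_cover.
have muF N : (lebesgue_measure (F N) <= (1 / (2 ^ N.+1)%:R)%:E)%E.
  pose G i := near_int_cover N (d N) (nth 0 (H N) i).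
  apply: (le_trans (Boole_inequality lebesgue_measure (A := G) _)).
    by move=> i _; exact: measurable_near_int_cover.
  apply: (@le_trans _ _ (\sum_(i < size (H N)) ((2 * N + 3)%:R * (2 * d N))%:E)%E).
    apply: lee_sum => i _; apply: measure_near_int_cover => //.
    by apply: contraNN (H0 N) => /eqP <-; rewrite mem_nth.
  by rewrite sumEFin lee_fin sumr_const card_ord -[leLHS]mulr_natl small.
exists (lim_sup_set F); split.
- by apply: bigcap_measurable => // k _; apply: bigcup_measurable => j _; exact: mF.
- apply: lim_sup_set_cvg0 => //.
apply: (@le_lt_trans _ _ (1 : R)%:E); last exact: ltry.
  apply: (le_trans _ (epsilon_trick0 xpredT (@ler01 R))).
  by apply: lee_nneseries => // k _; exact: muF.
- move=> alpha /= nex n _; apply: contrapT => nF; apply: nex.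
  (* The second entry ensures that [alpha] lies in the window [[-N, N]]. *)
  exists (maxn n (Num.truncn `|alpha|).+1) => N; rewrite geq_max => /andP[nN aN] h hH.
  rewrite leNgt; apply/negP => lt; apply: nF; exists N => //=.
  rewrite -(nth_index 0 hH) in lt *.
  have iH : (index h (H N) < size (H N))%N by rewrite index_mem.
  apply: (bigsetU_sup (F := fun i => near_int_cover N (d N) (nth 0 (H N) i)) iH).
  apply: near_int_coverP => //; first by apply: contraNN (H0 N) => /eqP <-; rewrite mem_nth.
  rewrite (le_trans (ltW (truncnS_gt _)))// ler_nat//.
Qed.

(** * Dense index sets with few differences *)

Definition first_terms (x : nat -> nat) (N : nat) (i : 'I_N) : int := (x i.+1)%:Z.

Lemma additive_energy_le (x : nat -> nat) (N : nat) :
  (additive_energy x N <=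
     \sum_p rep (difference (@first_terms x N)) (difference (@first_terms x N) p))%N.
Proof.
set X := @first_terms x N.
have -> : (\sum_p rep (difference X) (difference X p) =
    #|[set u : ('I_N * 'I_N) * ('I_N * 'I_N) | difference X u.2 == difference X u.1]|)%N.
  rewrite -[RHS]sum1_card [RHS]big_mkcond /= /rep.
  rewrite (pair_bigA _ (fun p q => (difference X q == difference X p) : nat)) /=.
  by apply: eq_bigr => u _; rewrite inE; case: eqP.
(* This rewrites [x_a + x_b = x_c + x_d] as [x_a - x_d = x_c - x_b]. *)
pose f (t : 'I_N * 'I_N * 'I_N * 'I_N) := ((t.1.2, t.1.1.2), (t.1.1.1, t.2)).
have finj : injective f.
  by move=> [[[a b] c] d] [[[a' b'] c'] d'] [-> -> -> ->].
rewrite /additive_energy -(card_imset _ finj); apply/subset_leq_card/fintype.subsetP.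
move=> _ /imsetP[[[[a b] c] d] + ->]; rewrite !inE /= /difference /X /first_terms /= => /eqP e.
by apply/eqP; lia.
Qed.

Lemma strict_mono_pos (x : nat -> nat) : (forall n, (1 <= n)%N -> (x n < x n.+1)%N) ->
  forall i j, (0 < i)%N -> (i < j)%N -> (x i < x j)%N.
Proof.
move=> xincr i j i0; elim: j => // j IH; rewrite ltnS leq_eqVlt => /predU1P[<-|ij].
  exact: xincr.
by apply: ltn_trans (IH ij) (xincr _ _); lia.
Qed.

(** One constant serves all [N]. The sets are predicates on [nat] and the differences are lists of
    integers, so that choices made for different [N] can be combined. *)
Lemma dense_few_differences (x : nat -> nat) (K : nat) :
  (forall n, (1 <= n)%N -> (x n < x n.+1)%N) ->
  (forall N, (1 <= N)%N -> (N ^ 3 <= K * additive_energy x N)%N) ->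
  exists C, (0 < C)%N /\ forall N, exists BL : pred nat * seq int,
    [/\ (N <= C * \sum_(1 <= i < N.+1) BL.1 i)%N, (size BL.2 <= C * N)%N &
        forall i j, (0 < i <= N)%N -> (0 < j <= N)%N -> BL.1 i -> BL.1 j ->
          (x i)%:Z - (x j)%:Z \in BL.2].
Proof.
move=> xincr energy; exists (8 * K + BSG_const K).+1; split => // N.
have [->|N0] := posnP N.
  by exists (fun=> false, [::]); split => //= i j; lia.
have xmono := strict_mono_pos xincr.
pose X := @first_terms x N.
have Xinj : injective X.
  move=> i j [] e; apply: val_inj => /=.
  have [ij|ij|//] := ltngtP i j.
  - by have := xmono i.+1 j.+1 isT ij; rewrite e ltnn.
  - by have := xmono j.+1 i.+1 isT ij; rewrite e ltnn.
have [|A [A1 A2]] := balog_szemeredi_gowers (K := K) Xinj.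
  by rewrite card_ord (leq_trans (energy _ N0))// leq_mul2l additive_energy_le orbT.
rewrite card_ord in A1 A2.
exists (fun i => [exists a in A, i == a.+1],
  undup [seq difference X p | p <- enum (finset.setX A A)]); split => /=.
- have -> : (\sum_(1 <= i < N.+1) [exists a in A, i == a.+1] = #|A|)%N.
    rewrite big_add1 /= big_mkord -sum1_card [RHS]big_mkcond; apply: eq_bigr => a _.
    have [aA|aA] := boolP (a \in A).
      have /fintype.exists_inP -> // : exists2 b, b \in A & a.+1 == b.+1.
      by exists a.
    rewrite (_ : [exists _ in _, _] = false)//; apply/negbTE/negP => /fintype.exists_inP[b bA].
    by rewrite eqSS => /eqP/val_inj ab; rewrite ab bA in aA.
  by rewrite (leq_trans A1)// leq_mul2r; apply/orP; right; lia.
- by rewrite (leq_trans A2)// leq_mul2r; apply/orP; right; lia.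
- move=> i j _ _ /fintype.exists_inP[a aA /eqP ->] /fintype.exists_inP[b bA /eqP ->].
  rewrite mem_undup; apply/mapP; exists (a, b) => //.
  by rewrite mem_enum; apply/finset.setXP.
Qed.

(** * Counting functions and enumeration of an infinite set *)

Definition count_upto (S : pred nat) (A : nat) : nat := (\sum_(1 <= i < A.+1) S i)%N.

Lemma count_uptoS (S : pred nat) A : count_upto S A.+1 = (count_upto S A + S A.+1)%N.
Proof. by rewrite /count_upto big_nat_recr. Qed.

Lemma count_upto_le (S : pred nat) : {homo count_upto S : m n / (m <= n)%N}.
Proof.
apply: homo_leq => // [|i]; first exact: leq_trans.
by rewrite count_uptoS leq_addr.
Qed.

Lemma sum_leq_const (c A : nat) : (c <= A)%N -> (\sum_(1 <= i < A.+1) (i <= c) = c)%N.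
Proof.
elim: A c => [|A IH] c cA; first by rewrite big_nil; lia.
rewrite big_nat_recr//=; have [cle|] := leqP c A.
  by rewrite IH//; lia.
move=> Ac; have -> : c = A.+1 by lia.
rewrite (eq_big_nat _ _ (F2 := fun=> 1%N)).
  by rewrite sum_nat_const_nat; lia.
by move=> i /andP[_ iA]; lia.
Qed.

(** With [n k] the least index at which the count reaches [k], one has [n k <= A] exactly when
    [k <= count_upto S A]; all four properties follow from this. *)
Lemma enumerate (S : pred nat) : (forall k, exists i, (k <= count_upto S i)%N) ->
  exists n : nat -> nat,
    [/\ forall k, (0 < k)%N -> (0 < n k)%N /\ S (n k),
        forall k, (0 < k)%N -> count_upto S (n k) = k,
        forall k, (0 < k)%N -> (n k < n k.+1)%N &
        forall A, count_le n A = count_upto S A].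
Proof.
move=> unb; pose n k := ex_minn (unb k); exists n.
have nP k A : (n k <= A)%N = (k <= count_upto S A)%N.
  rewrite /n; case: ex_minnP => m km min; apply/idP/idP => [mA|/min//].
  exact: leq_trans km (count_upto_le _ mA).
have nS k : (0 < k)%N -> exists m, [/\ n k = m.+1, S m.+1 & count_upto S m.+1 = k].
  move=> k0; have := nP k (n k); rewrite leqnn => /esym.
  case E : (n k) => [|m]; first by rewrite /count_upto big_nil; lia.
  have := nP k m; rewrite E ltnn => /esym/negbT; rewrite -ltnNge count_uptoS => lt le.
  exists m; rewrite count_uptoS; split => //; move: le; case: (S m.+1) => //=; lia.
have nc k : (0 < k)%N -> count_upto S (n k) = k by move=> /nS[m [-> _ ->]].
split => //.
- by move=> k /nS[m [-> ? _]].
- by move=> k k0; rewrite ltnNge nP nc// ltnn.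
- move=> A; rewrite /count_le; under eq_bigr => k _ do rewrite nP.
  apply: sum_leq_const; elim: A => [|A]; first by rewrite /count_upto big_nil.
  by rewrite count_uptoS; case: (S _); lia.
Qed.

(** * Rapidly growing scales and unions of blocks *)

(* The first summand makes [ln (scale N.+1)] absorb the number of differences at
   scale [N.+1] and the length of [[- N.+1, N.+1]], with a summable rest
   [1 / 2 ^ N.+2]; the second one keeps the density. *)
Definition scale_exponent (C N s : nat) : nat :=
  ((C + 2 * s) * ((2 * N + 5) * (2 * 2 ^ N.+2)) + 2 * C * s)%N.

(** Scales are powers of [b] so that, once [ln b >= 1], the logarithm of a scale is at least its
    exponent. *)
Fixpoint scale (b C N : nat) : nat :=
  if N is N'.+1 then (b ^ scale_exponent C N' (scale b C N'))%N else 1%N.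

Lemma scale_growth (b C N : nat) : (1 < b)%N -> (2 * C * scale b C N < scale b C N.+1)%N.
Proof.
move=> b1 /=; apply: leq_ltn_trans (ltn_expl _ b1).
by rewrite /scale_exponent leq_addl.
Qed.

Definition block_union (s : nat -> nat) (B : nat -> pred nat) : pred nat :=
  fun i => `[< exists2 N, (s N < i <= s N.+1)%N & B (s N.+1) i >].

Lemma block_unionE (s : nat -> nat) (B : nat -> pred nat) (N i : nat) :
  {homo s : m n / (m <= n)%N} -> (s N < i <= s N.+1)%N ->
  block_union s B i = B (s N.+1) i.
Proof.
move=> smono /andP[Ni iN]; apply/asboolP/idP => [[M /andP[Mi iM]]|Bi]; last first.
  by exists N => //; rewrite Ni.
have [MN|NM|->//] := ltngtP M N.
- by have := smono _ _ MN; lia.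
- by have := smono _ _ NM; lia.
Qed.

(** Only indices up to [s N] can be lost; above them the union agrees with the last set. *)
Lemma count_block_union (s : nat -> nat) (B : nat -> pred nat) (N : nat) :
  {homo s : m n / (m <= n)%N} ->
  (count_upto (B (s N.+1)) (s N.+1) <= s N + count_upto (block_union s B) (s N.+1))%N.
Proof.
move=> smono; rewrite -(sum_leq_const (smono _ _ (leqnSn N))) /count_upto -big_split /=.
rewrite big_nat_cond [leqRHS]big_nat_cond; apply: leq_sum => i /andP[/andP[_ iN] _].
have [_|Ni] := leqP i (s N); first by case: (B _ _); lia.
have Nii : (s N < i <= s N.+1)%N by rewrite Ni.
by rewrite (block_unionE B smono Nii).
Qed.

(** * The differences occurring at a given scale *)

Definition cross_differences (x : nat -> nat) (m n : nat) : seq int :=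
  [seq (x i)%:Z - (x j)%:Z | i <- iota 1 m, j <- iota 1 n].

(** [L (s N)] handles two indices of the last block. If one index is at most [s N'], all differences
    are listed, in both orders. Zero is removed because the covering estimate divides by [h]. *)
Definition gap_list (x : nat -> nat) (L : nat -> seq int) (s : nat -> nat) (N : nat) : seq int :=
  if N is N'.+1 then
    [seq h <- L (s N) ++ cross_differences x (s N') (s N)
                ++ cross_differences x (s N) (s N') | h != 0]
  else [::].

Lemma size_gap_list (x : nat -> nat) (L : nat -> seq int) (s : nat -> nat) (C N : nat) :
  (size (L (s N.+1)) <= C * s N.+1)%N ->
  (size (gap_list x L s N.+1) <= (C + 2 * s N) * s N.+1)%N.
Proof.
move=> hL; rewrite /gap_list size_filter (leq_trans (count_size _ _))//.
rewrite !size_cat !size_allpairs !size_iota; nia.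
Qed.

Lemma mem_gap_list (x : nat -> nat) (L : nat -> seq int) (s : nat -> nat)
    (B : nat -> pred nat) (N i j : nat) :
  {homo s : m n / (m <= n)%N} ->
  (forall i j, (0 < i <= s N.+1)%N -> (0 < j <= s N.+1)%N ->
     B (s N.+1) i -> B (s N.+1) j -> (x i)%:Z - (x j)%:Z \in L (s N.+1)) ->
  (0 < i <= s N.+1)%N -> (0 < j <= s N.+1)%N -> x i != x j ->
  block_union s B i -> block_union s B j ->
  (x i)%:Z - (x j)%:Z \in gap_list x L s N.+1.
Proof.
move=> smono hL iN jN xij Si Sj; rewrite mem_filter subr_eq0 xij /= !mem_cat.
have [iN'|Ni] := leqP i (s N).
  apply/orP; right; apply/orP; left; apply/allpairsP; exists (i, j).
  by rewrite /= !mem_iota; split => //; lia.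
have [jN'|Nj] := leqP j (s N).
  apply/orP; right; apply/orP; right; apply/allpairsP; exists (i, j).
  by rewrite /= !mem_iota; split => //; lia.
apply/orP; left; apply: hL => //.
- have Nii : (s N < i <= s N.+1)%N by lia.
  by rewrite -(block_unionE B smono Nii).
- have Njj : (s N < j <= s N.+1)%N by lia.
  by rewrite -(block_unionE B smono Njj).
Qed.

(** * Logarithms of the scales and numerical constants *)

Lemma ln_scale_ge (R : realType) (b C N : nat) : 1 <= ln (b%:R : R) -> (1 < b)%N ->
  (scale_exponent C N (scale b C N))%:R <= ln (scale b C N.+1)%:R :> R.
Proof.
move=> lnb b1 /=; rewrite natrX lnXn ?ltr0n ?(ltnW b1)//.
by rewrite -[leRHS]mulr_natr ler_peMl.
Qed.

Lemma exists_base (R : realType) : exists2 b, (1 < b)%N & 1 <= ln (b%:R : R).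
Proof.
exists (Num.truncn (expR 1 : R)).+1.
  rewrite -(ltr_nat R); apply: lt_trans (truncnS_gt _).
  by rewrite expR_gt1.
rewrite -[leLHS]expRK ler_ln ?posrE ?expR_gt0 ?ltr0n//.
exact/ltW/truncnS_gt.
Qed.

(** Replacing [r] by a natural number above [1 / r] keeps the combinatorics within [nat]. *)
Lemma energy_constant (R : realType) (x : nat -> nat) (r : R) : 0 < r ->
  (forall N : nat, (1 <= N)%N -> r * (N%:R) ^+ 3 <= (additive_energy x N)%:R) ->
  exists K, forall N, (1 <= N)%N -> (N ^ 3 <= K * additive_energy x N)%N.
Proof.
move=> r0 energy; exists (Num.truncn r^-1).+1 => N /energy rN.
rewrite -(ler_nat R) natrM natrX.
rewrite -(ler_pM2l r0) (le_trans rN)// mulrA ler_peMl//.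
by rewrite mulrC -ler_pdivrMr// mul1r ltW// truncnS_gt.
Qed.

(** * Construction of the subsequence and its gap bound *)

Theorem theorem9 (R : realType) (x : nat -> nat) :
  (forall n, (1 <= n)%N -> (0 < x n)%N) ->
  (forall n, (1 <= n)%N -> (x n < x n.+1)%N) ->
  (exists r : R, 0 < r /\
     forall N : nat, (1 <= N)%N -> r * (N%:R) ^+ 3 <= (additive_energy x N)%:R) ->
  exists (n a : nat -> nat),
    (forall k, (1 <= k)%N -> (1 <= n k)%N /\ (n k < n k.+1)%N) /\
    (forall N, (1 <= N)%N -> (1 <= a N)%N /\ (a N <= a N.+1)%N) /\
    (forall M : nat, exists N0 : nat, forall N, (N0 <= N)%N -> (M <= a N)%N) /\
    (exists c : R, 0 < c /\
       forall N, (1 <= N)%N -> c * (a N)%:R <= (count_le n (a N))%:R) /\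
    (forall eps : R, 0 < eps ->
       {ae (@lebesgue_measure R), forall alpha : R,
          exists C : R, 0 < C /\
          exists N0 : nat, forall N k l, (N0 <= N)%N ->
            (1 <= k)%N -> (1 <= l)%N -> k <> l ->
            (n k <= a N)%N -> (n l <= a N)%N ->
            C / ((a N)%:R * (ln (a N)%:R) `^ (1 + eps))
              <= distZ (alpha * (x (n k))%:R - alpha * (x (n l))%:R)}).
Proof.
move=> _ xincr [r [r0 /(energy_constant r0)[K energy]]].
have [C [C0 /choice[BL hBL]]] := dense_few_differences xincr energy.
have [b b1 lnb] := exists_base R.
pose s := scale b C.
pose B N := (BL N).1; pose L N := (BL N).2.
have sgrow N : (2 * C * s N < s N.+1)%N by exact: scale_growth.
have slt N : (s N < s N.+1)%N by apply: leq_ltn_trans (sgrow N); nia.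
have smono : {homo s : m n / (m <= n)%N}.
  by apply: homo_leq => // [? ? ?|i]; [exact: leq_trans|exact/ltnW].
have sN N : (N < s N)%N by elim: N => // N IH; exact: leq_ltn_trans IH (slt N).
pose S := block_union s B.
(* The previous scale is less than [s N.+1 / (2 * C)], so discarding it costs at most half of the
   density [1 / C]. *)
have dens N : (s N.+1 <= 2 * C * count_upto S (s N.+1))%N.
  have many : (s N.+1 <= C * count_upto (B (s N.+1)) (s N.+1))%N by have [] := hBL (s N.+1).
  move: many (count_block_union B N smono) (sgrow N); rewrite -/S.
  by move: (count_upto (B _) _) (count_upto S _) => u v; nia.
have [k|n [n1 nc ninc ncount]] := enumerate (S := S).
  exists (s (2 * C * k).+1); have := dens (2 * C * k)%N.
  have := sN (2 * C * k).+1; nia.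
have xlt := strict_mono_pos xincr.
have xinj i j : (0 < i)%N -> (0 < j)%N -> i != j -> x i != x j.
  move=> i0 j0; rewrite !neq_ltn => /orP[ij|ji]; first by rewrite xlt.
  by rewrite (xlt j i) ?orbT.
exists n, s; split; [|split; [|split; [|split]]].
- by move=> k k1; split; [exact: (n1 k k1).1|exact: ninc].
- by move=> N _; split; [exact: leq_ltn_trans (sN N)|exact/ltnW].
- by move=> M; exists M => N MN; apply: leq_trans MN (ltnW (sN N)).
- exists (2 * C)%:R^-1; split; first by rewrite invr_gt0 ltr0n muln_gt0 C0.
  case=> // N _; rewrite ncount ler_pdivrMl ?ltr0n ?muln_gt0 ?C0//.
  by rewrite -natrM ler_nat.
move=> eps eps0.
(* No [eps] enters here. Since [s 0 = 1], [d 0] is the inverse of 0, that is 0; [H 0] is empty. *)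
pose d N : R := ((s N)%:R * ln (s N)%:R)^-1.
have ln_s N : (scale_exponent C N (s N))%:R <= ln (s N.+1)%:R :> R by exact: ln_scale_ge.
have lns1 N : 1 <= ln (s N.+1)%:R :> R.
  apply: le_trans (ln_s N); rewrite ler1n /scale_exponent.
  by have := sN N; nia.
have d0 N : 0 <= d N.
  by rewrite invr_ge0 mulr_ge0// ln_ge0// ler1n (leq_ltn_trans _ (sN N)).
pose H := gap_list x L s.
have H0 N : 0 \notin H N by case: N => // N; rewrite mem_filter eqxx.
have small N : (size (H N))%:R * ((2 * N + 3)%:R * (2 * d N)) <= 1 / (2 ^ N.+1)%:R.
  case: N => [|N]; first by rewrite mul0r divr_ge0.
  have [_ Lsize _] := hBL (s N.+1).
  have Hsize : (size (H N.+1) <= (C + 2 * s N) * s N.+1)%N by exact: size_gap_list.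
  have ss : 0 < (s N.+1)%:R :> R by rewrite ltr0n (leq_ltn_trans _ (sN _)).
  have ll : 0 < ln (s N.+1)%:R :> R by exact: lt_le_trans ltr01 (lns1 N).
  rewrite ler_pdivlMr ?ltr0n ?expn_gt0// /d !mulrA -!natrM mulrAC.
  rewrite ler_pdivrMr ?mulr_gt0// mul1r -natrM.
  (* With the denominators cleared, [s N.+1] cancels and the first summand of [scale_exponent]
     remains to be compared with the logarithm. *)
  apply: (@le_trans _ _ ((s N.+1)%:R * (scale_exponent C N (s N))%:R)); last first.
    by rewrite ler_wpM2l.
  rewrite -natrM ler_nat /scale_exponent.
  rewrite (_ : 2 * N.+1 + 3 = 2 * N + 5)%N; last by lia.
  rewrite -(mulnA _ 2) -mulnA (leq_trans (leq_mul Hsize (leqnn _)))//.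
  by rewrite (mulnC (C + _)%N) -mulnA leq_mul2l leq_addr orbT.
have [Z [mZ Z0 subZ]] := ae_distZ_ge H0 d0 small.
exists Z; split=> // alpha; apply: contra_notP => /= nZ.
have {nZ} [N0 hN0] := contra_notP (subZ alpha) nZ.
(* Only the threshold depends on [alpha]; its successor makes the scale index positive, as
   [gap_list] requires. *)
exists 1; split => //; exists N0.+1 => -[//|N] k l NN k1 l1 kl nk nl.
have nkl : n k != n l.
  by apply/eqP => e; apply: kl; rewrite -(nc k k1) -(nc l l1) e.
have [nk0 Sk] := n1 k k1; have [nl0 Sl] := n1 l l1.
have [_ _ hL] := hBL (s N.+1).
have hH : (x (n k))%:Z - (x (n l))%:Z \in H N.+1.
  by apply: (mem_gap_list smono hL); [exact/andP|exact/andP|exact: xinj|exact: Sk|exact: Sl].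
have := hN0 N.+1 (leq_trans (ltnW NN) (leqnn _)) _ hH.
rewrite intrB mulrBr; apply: le_trans; rewrite div1r /d.
have ss : 0 < (s N.+1)%:R :> R by rewrite ltr0n (leq_ltn_trans _ (sN _)).
have ll : 0 < ln (s N.+1)%:R :> R by exact: lt_le_trans ltr01 (lns1 N).
(* As the logarithm is at least 1, raising it to the power [1 + eps] only weakens the bound
   [d N.+1]. *)
rewrite lef_pV2 ?posrE ?mulr_gt0 ?powR_gt0// ler_pM2l// le1r_powR//.
by rewrite lerDl ltW.
Qed.
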